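(* Let $m\ge1$ be an integer and $0<q<1$. On $\mathscr P_m=\mathbb C[z_1,\dots,z_m,w_1,\dots,w_m]\otimes\bigwedge\mathbb C^m$ the operators $$\mathcal D_q=\sum_{i}\varepsilon_iD_{q,z_i},\quad \mathcal D_q^\dagger=\sum_i\iota_iD_{q,w_i},\quad \mathcal Z=\sum_i\iota_iz_i,\quad \mathcal Z^\dagger=\sum_i\varepsilon_iw_i$$ satisfy $$\mathcal D_q^2=(\mathcal D_q^\dagger)^2=\mathcal Z^2=(\mathcal Z^\dagger)^2=0,$$ $$\{\mathcal Z,\mathcal Z^\dagger\}=\sum_{i=1}^m z_iw_i,\qquad \{\mathcal D_q,\mathcal D_q^\dagger\}=\sum_{i=1}^m D_{q,z_i}D_{q,w_i},$$ $$\{\mathcal D_q,\mathcal Z^\dagger\}=0,\qquad \{\mathcal D_q^\dagger,\mathcal Z\}=0,$$ and $$\{\mathcal D_q,\mathcal Z\}=\sum_{i=1}^m\bigl(N_i+q^{N_i}E_{q,z_i}\bigr),\qquad \{\mathcal D_q^\dagger,\mathcal Z^\dagger\}=\sum_{i=1}^m\bigl(1-N_i+q^{1-N_i}E_{q,w_i}\bigr),$$ where $E_{q,z_i}=z_iD_{q,z_i}$ and $E_{q,w_i}=w_iD_{q,w_i}$.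
   Context: $\{X,Y\}=XY+YX$. All variables $z_i,w_i$ commute and are algebraically independent. For a coordinate $x$ among them, the Jackson derivative is $D_{q,x}f=\frac{f(\dots,qx,\dots)-f(\dots,x,\dots)}{(q-1)x}$ (a polynomial), so $D_{q,x}x^r=[r]_qx^{r-1}$ with $[r]_q=\frac{1-q^r}{1-q}$; it acts on the polynomial factor of $\mathscr P_m$. A coordinate written as an operator means multiplication by it. $\varepsilon_i$ is exterior multiplication by the $i$-th standard basis vector on $\bigwedge\mathbb C^m$ and $\iota_i=\varepsilon_i^*$ is the corresponding contraction (adjoint for the standard inner product), so $\varepsilon_i\varepsilon_j+\varepsilon_j\varepsilon_i=0$, $\iota_i\iota_j+\iota_j\iota_i=0$, $\varepsilon_i\iota_j+\iota_j\varepsilon_i=\delta_{ij}I$. $N_i=\varepsilon_i\iota_i$ is a projection; $q^{N_i}$ is defined by functional calculus ($q$ on the range of $N_i$, $1$ on its kernel), and likewise $q^{1-N_i}$. *)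

(* Defs.v *)
From HB Require Import structures.
From mathcomp Require Import all_boot all_order all_algebra.
From mathcomp Require Import reals complex mpoly.

Set Implicit Arguments.
Unset Strict Implicit.
Unset Printing Implicit Defensive.

Import Order.TTheory GRing.Theory Num.Theory.

Local Open Scope ring_scope.
Local Open Scope complex_scope.

Section Jackson.
Context {F : fieldType} {n : nat}.
Implicit Types (i : 'I_n) (p : {mpoly F[n]}) (q : F).

Definition dilate q i p : {mpoly F[n]} :=
  p \mPo [tuple (if j == i then q *: 'X_j else 'X_j) | j < n].

(* The quotient of p by 'X_i: monomials not divisible by 'X_i are dropped, so
   this is the exact quotient when 'X_i divides p, which is always the case
   for [dilate q i p - p]; see [jacksonP]. *)
Definition mdivX i p : {mpoly F[n]} :=
  \sum_(k <- msupp p | (0 < k i)%N) p@_k *: 'X_[k - U_(i)].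

Definition jackson q i p : {mpoly F[n]} :=
  (q - 1)^-1 *: mdivX i (dilate q i p - p).

Definition mulX i p : {mpoly F[n]} := 'X_i * p.

Definition qEuler q i p : {mpoly F[n]} := mulX i (jackson q i p).

Lemma mdivXK i p :
  (forall k : 'X_{1..n}, k i = 0%N -> p@_k = 0) -> 'X_i * mdivX i p = p.
Proof.
move=> p0; rewrite /mdivX mulr_sumr [RHS]mpolyE big_mkcond /=.
apply: eq_bigr => k _; case: posnP => [/p0->|k_gt0]; first by rewrite scale0r.
rewrite -scalerAr -mpolyXD addmC submK //.
by apply/mnm_lepP => j; rewrite mnmE; case: eqP => [<-|].
Qed.

Lemma dilateX q i (k : 'X_{1..n}) : dilate q i 'X_[k] = q ^+ k i *: 'X_[k].
Proof.
rewrite /dilate comp_mpolyX [in RHS]mpolyXE_id.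
rewrite (bigD1 i) //= [in RHS](bigD1 i) //= tnth_mktuple eqxx exprZn.
rewrite -scalerAl; congr (_ *: (_ * _)).
by apply: eq_bigr => j /negPf ji; rewrite tnth_mktuple ji.
Qed.

Lemma mcoeff_dilate q i p (k : 'X_{1..n}) :
  (dilate q i p)@_k = q ^+ k i * p@_k.
Proof.
transitivity (\sum_(l <- msupp p) p@_l * (dilate q i 'X_[l])@_k).
  rewrite /dilate comp_mpolyEX linear_sum; apply: eq_bigr => l _.
  exact: mcoeffZ.
rewrite [in RHS](mpolyE p) linear_sum mulr_sumr; apply: eq_bigr => l _ /=.
rewrite dilateX !mcoeffZ mcoeffX.
by case: eqP => [->|]; rewrite ?mulr1 ?mulr0 // mulrC.
Qed.

Lemma jacksonP q i p :
  q != 1 -> ((q - 1) *: 'X_i) * jackson q i p = dilate q i p - p.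
Proof.
move=> q1; rewrite /jackson -scalerAl -scalerAr scalerA mulfV ?subr_eq0 //.
rewrite scale1r mdivXK // => k k0.
by rewrite mcoeffB mcoeff_dilate k0 expr0 mul1r subrr.
Qed.

End Jackson.

(* The exterior algebra of C^m, in the coordinates of its standard orthonormal
   basis e_S = e_{s_1} /\ ... /\ e_{s_k}, S = {s_1 < ... < s_k}. *)
Notation ext R m := {ffun {set 'I_m} -> R[i]^o}.

(* C[z_1..z_m, w_1..w_m] (x) ext, as the free C[z, w]-module on the e_S. *)
Notation Pm R m := {ffun {set 'I_m} -> {mpoly R[i][m + m]}}.

Section Exterior.
Context {R : realType} {m : nat}.

Local Notation ext := (ext R m).

Implicit Types (u v : ext) (A : ext -> ext) (S T : {set 'I_m}) (i : 'I_m).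

Definition ext_basis S : ext := [ffun T => (T == S)%:R].

(* Number of inversions: e_S /\ e_T = (-1) ^+ inversions S T * e_(S :|: T) for
   disjoint S and T. *)
Definition inversions S T : nat := #|[set p in setX S T | (p.2 < p.1)%N]|.

Definition wedge u v : ext :=
  [ffun T => \sum_(S in powerset T)
     (-1) ^+ inversions S (T :\: S) * (u S * v (T :\: S))].

Definition ext_dot u v : R[i] := \sum_S u S * Num.conj (v S : R[i]).

Definition adjoint A : ext -> ext :=
  fun u => [ffun S => ext_dot u (A (ext_basis S))].

Definition eps i : ext -> ext := wedge (ext_basis [set i]).
Definition iota_ i : ext -> ext := adjoint (eps i).
Definition numop i : ext -> ext := eps i \o iota_ i.

Definition compl A : ext -> ext := fun u => u - A u.

(* q ^ P for a projection P: q on the range of P, 1 on its kernel. *)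
Definition qpow (q : R[i]) A : ext -> ext := fun u => q *: A u + compl A u.

Lemma ext_decomp u : u = \sum_S (u S : R[i]) *: ext_basis S.
Proof.
apply/ffunP => T; rewrite sum_ffunE (bigD1 T) //= big1 ?addr0; last first.
  by move=> S /negPf ST; rewrite !ffunE eq_sym ST scaler0.
by rewrite !ffunE eqxx /GRing.scale /= mulr1.
Qed.

Lemma adjointP (A : {linear ext -> ext}) u v :
  ext_dot (A u) v = ext_dot u (adjoint A v).
Proof.
rewrite {1}(ext_decomp u) linear_sum /ext_dot.
under eq_bigr do rewrite sum_ffunE mulr_suml.
rewrite exchange_big /=; apply: eq_bigr => S _.
rewrite ffunE /ext_dot rmorph_sum mulr_sumr; apply: eq_bigr => T _.
rewrite linearZ /= ffunE rmorphM /= conjCK -mulrA; congr (_ * _).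
by rewrite mulrC.
Qed.

Fact wedge_is_linear u : linear (wedge u).
Proof.
move=> a v w; apply/ffunP => T; rewrite !ffunE /GRing.scale /= mulr_sumr.
rewrite -big_split /=; apply: eq_bigr => S _; rewrite !ffunE /GRing.scale /=.
by rewrite !mulrDr [u S * (a * _)]mulrCA [_ * (a * _)]mulrCA.
Qed.

HB.instance Definition _ u :=
  GRing.isLinear.Build R[i] ext ext _ (wedge u) (wedge_is_linear u).
HB.instance Definition _ i :=
  GRing.isLinear.Build R[i] ext ext _ (eps i) (wedge_is_linear _).

End Exterior.

Section Spinors.
Context {R : realType} {m : nat}.

Local Notation Pm := (Pm R m).
Local Notation zwpoly := {mpoly R[i][m + m]}.

(* The variables of C[z_1, ..., z_m, w_1, ..., w_m]. *)
Definition zvar (i : 'I_m) : 'I_(m + m) := lshift m i.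
Definition wvar (i : 'I_m) : 'I_(m + m) := rshift m i.

Implicit Types (f : Pm) (D : zwpoly -> zwpoly) (A : ext R m -> ext R m).
Implicit Types (q : R[i]).

Definition tensor (p : zwpoly) (u : ext R m) : Pm :=
  [ffun S => (u S : R[i]) *: p].

(* The operators id (x) A and D (x) id; see [ext_op_tensor], [pol_op_tensor]. *)
Definition ext_op A : Pm -> Pm :=
  fun f => [ffun T => \sum_S (A (ext_basis S) T : R[i]) *: f S].
Definition pol_op D : Pm -> Pm := fun f => [ffun T => D (f T)].

Lemma ext_op_tensor (A : {linear ext R m -> ext R m}) p u :
  ext_op A (tensor p u) = tensor p (A u).
Proof.
apply/ffunP => T; rewrite !ffunE [in RHS](ext_decomp u) linear_sum sum_ffunE.
rewrite scaler_suml; apply: eq_bigr => S _.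
by rewrite !ffunE scalerA linearZ /= ffunE /GRing.scale /= mulrC.
Qed.

Lemma pol_op_tensor (D : {linear zwpoly -> zwpoly}) p u :
  pol_op D (tensor p u) = tensor (D p) u.
Proof. by apply/ffunP => T; rewrite !ffunE linearZ. Qed.

Definition anticomm (A B : Pm -> Pm) : Pm -> Pm := (A \o B) \+ (B \o A).

Definition Dq q : Pm -> Pm :=
  fun f => \sum_i ext_op (eps i) (pol_op (jackson q (zvar i)) f).
Definition Dq_dag q : Pm -> Pm :=
  fun f => \sum_i ext_op (iota_ i) (pol_op (jackson q (wvar i)) f).
Definition Zop : Pm -> Pm :=
  fun f => \sum_i ext_op (iota_ i) (pol_op (mulX (zvar i)) f).
Definition Zop_dag : Pm -> Pm :=
  fun f => \sum_i ext_op (eps i) (pol_op (mulX (wvar i)) f).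

End Spinors.

(* Main.v *)
From HB Require Import structures.
Require Import Defs.
From mathcomp Require Import all_boot all_order all_algebra.
From mathcomp Require Import reals complex mpoly ring.

(* Every operator in the statement is a sum of terms A_i (x) D_i. When A_i and
   B_j anticommute and D_i and G_j commute, the (i, j) cross term of the
   anticommutator cancels. Only the diagonal terms remain; there e_S is a
   common eigenvector of eps_i iota_i and iota_i eps_i, so both sides are
   compared on the components with i in S and i not in S. The q-deformation
   comes from the rule D_q x = 1 + q x D_q. *)

Set Implicit Arguments.
Unset Strict Implicit.
Unset Printing Implicit Defensive.

Import Order.TTheory GRing.Theory Num.Theory.

Local Open Scope ring_scope.
Local Open Scope complex_scope.

(** * Commutation rules of dilations, Jackson derivatives and multiplications *)

Section JacksonTheory.
Context {F : fieldType} {n : nat}.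
Implicit Types (i j : 'I_n) (p : {mpoly F[n]}) (q : F).

Fact dilate_is_linear q i : linear (@dilate F n q i).
Proof. exact: linearP. Qed.

HB.instance Definition _ q i :=
  GRing.isLinear.Build F {mpoly F[n]} {mpoly F[n]} _ (dilate q i)
    (dilate_is_linear q i).

Lemma dilateM q i : {morph @dilate F n q i : p r / p * r}.
Proof. exact: rmorphM. Qed.

Lemma dilate_var q i j : dilate q i 'X_j = (if j == i then q *: 'X_j else 'X_j).
Proof. by rewrite dilateX mnm1E; case: eqP => _; rewrite ?scale1r. Qed.

Lemma dilateC q i j p : dilate q i (dilate q j p) = dilate q j (dilate q i p).
Proof. by apply/mpolyP => k; rewrite !mcoeff_dilate mulrCA. Qed.

(** Licenses the cancellation behind the [jackson] identities below: multiplying by this factor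
    turns [jackson q i p] into [dilate q i p - p], by [jacksonP]. *)
Lemma scaleX_neq0 q i : q != 1 -> (q - 1) *: 'X_i != 0 :> {mpoly F[n]}.
Proof.
by move=> q1; rewrite scaler_eq0 subr_eq0 negb_or q1 -msupp_eq0 msuppX.
Qed.

Fact jackson_is_linear q i : linear (@jackson F n q i).
Proof.
move=> a p r; have [->|q1] := eqVneq q 1.
  (* At [q = 1] the prefactor is the inverse of 0, which is 0 by convention, so [jackson] is the
     zero map. *)
  by rewrite /jackson subrr invr0 !scale0r scaler0 addr0.
apply: (mulfI (scaleX_neq0 i q1)).
rewrite mulrDr -(scalerAr a) !jacksonP // linearP /= scalerBr.
by rewrite opprD addrACA.
Qed.

HB.instance Definition _ q i :=
  GRing.isLinear.Build F {mpoly F[n]} {mpoly F[n]} _ (jackson q i)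
    (jackson_is_linear q i).

Fact mulX_is_linear i : linear (@mulX F n i).
Proof. by move=> a p r; rewrite /mulX mulrDr scalerAr. Qed.

HB.instance Definition _ i :=
  GRing.isLinear.Build F {mpoly F[n]} {mpoly F[n]} _ (mulX i)
    (mulX_is_linear i).

Lemma mulXC i j p : mulX i (mulX j p) = mulX j (mulX i p).
Proof. exact: mulrCA. Qed.

(** With x for ['X_i] and d for the multiplicative map [dilate q i], cancellation reduces this to q
    x d(p) - x p = (q - 1) x p + q x (d(p) - p). *)
Lemma jackson_mulX q i p :
  q != 1 -> jackson q i (mulX i p) = p + q *: mulX i (jackson q i p).
Proof.
move=> q1; apply: (mulfI (scaleX_neq0 i q1)).
rewrite jacksonP // mulrDr /mulX -(scalerAr q) mulrCA jacksonP //.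
by rewrite dilateM dilate_var eqxx -!mul_mpolyC mpolyCB mpolyC1; ring.
Qed.

Lemma jackson_mulXC q i j p :
  q != 1 -> i != j -> jackson q i (mulX j p) = mulX j (jackson q i p).
Proof.
move=> q1 ij; apply: (mulfI (scaleX_neq0 i q1)).
rewrite /mulX mulrCA !jacksonP // dilateM dilate_var eq_sym (negPf ij).
by rewrite mulrBr.
Qed.

Lemma dilateZ q i (c : F) p : dilate q i (c *: p) = c *: dilate q i p.
Proof. exact: linearZ. Qed.

Lemma jackson_dilate q i j p :
  q != 1 -> i != j -> jackson q j (dilate q i p) = dilate q i (jackson q j p).
Proof.
move=> q1 ij; apply: (mulfI (scaleX_neq0 j q1)).
rewrite jacksonP // dilateC.
(* Dilation in ['X_i] fixes the denominator of the derivative in ['X_j], so that factor can be moved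
   inside the dilation. *)
have <- : dilate q i ((q - 1) *: 'X_j) = (q - 1) *: 'X_j.
  by rewrite dilateZ dilate_var eq_sym (negPf ij).
by rewrite -dilateM jacksonP // linearB.
Qed.

(** The derivative in ['X_j] commutes with dilation in ['X_i], hence acts on the difference
    [dilate q i p - p]; the factor ['X_i] of that difference then passes out of it. *)
Lemma jacksonC q i j p :
  q != 1 -> i != j ->
  jackson q i (jackson q j p) = jackson q j (jackson q i p).
Proof.
move=> q1 ij; apply: (mulfI (scaleX_neq0 i q1)).
rewrite jacksonP // -jackson_dilate // -linearB -jacksonP //.
rewrite -!scalerAl linearZ; congr (_ *: _).
by apply: jackson_mulXC; rewrite // eq_sym.
Qed.

End JacksonTheory.

(** * Coordinate formulas and anticommutation relations of [eps] and [iota_] *)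

Section ExteriorTheory.
Context {R : realType} {m : nat}.
Implicit Types (u v : ext R m) (S T : {set 'I_m}) (i j : 'I_m).

(** The sign of sorting e_i into place: for [i \in T], the product of e_i and e_(T :\ i) is this
    sign times e_T. *)
Definition ext_sign i T : R[i] := (-1) ^+ #|[set j in T | (j < i)%N]|.

Lemma ext_signK i T : ext_sign i T * ext_sign i T = 1.
Proof. by rewrite -expr2 sqrr_sign. Qed.

Lemma ext_signU1 i j T :
  i \notin T -> ext_sign j (i |: T) = (-1) ^+ (i < j)%N * ext_sign j T.
Proof.
move=> iT; rewrite /ext_sign -exprD; congr (_ ^+ _).
have [ij|ij] := boolP (i < j)%N.
  rewrite (_ : [set k in i |: T | _] = i |: [set k in T | (k < j)%N]).
    by rewrite cardsU1 inE (negPf iT).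
  by apply/setP => k; rewrite !inE; case: eqP => [->|] //; rewrite ij.
rewrite add0n; apply: eq_card => k; rewrite !inE.
by case: eqP => [->|//]; rewrite (negPf ij) !andbF.
Qed.

Lemma ext_signD1 i j T :
  i \in T -> ext_sign j (T :\ i) = (-1) ^+ (i < j)%N * ext_sign j T.
Proof.
move=> iT; rewrite -{2}(setD1K iT) ext_signU1 ?setD11 //.
by rewrite mulrA -expr2 sqrr_sign mul1r.
Qed.

(** Only [S = [set i]] survives in the sum defining [wedge]; its inversions against the rest of [T]
    are the pairs (i, j) with j in [T] below [i]. *)
Lemma epsE i u T :
  eps i u T = if i \in T then ext_sign i T * u (T :\ i) else 0.
Proof.
rewrite ffunE; case: ifPn => iT; last first.
  apply: big1 => S; rewrite powersetE ffunE => ST.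
  case: eqP => [SE|_]; last by rewrite mul0r mulr0.
  by move: ST; rewrite SE sub1set (negPf iT).
rewrite (bigD1 [set i]) ?powersetE ?sub1set //= big1 ?addr0.
  rewrite ffunE eqxx mul1r; congr (_ ^+ _ * _).
  rewrite /inversions.
  rewrite -(card_imset (mem [set j in T | (j < i)%N]) (f := pair i)).
    apply: eq_card => -[a b]; rewrite !inE /=.
    apply/idP/imsetP => [/andP[/andP[/eqP-> /andP[_ bT]] bi]|[k]].
      by exists b; rewrite // inE bT.
    rewrite inE => /andP[kT ki] [-> ->].
    by rewrite eqxx kT ki !andbT /= neq_ltn ki.
  by move=> a b [].
by move=> S /andP[_ /negPf Si]; rewrite ffunE Si mul0r mulr0.
Qed.

(** The adjoint pairs [u] with [eps i] applied to e_T, which is 0 if [i \in T] and otherwise a sign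
    times e_(i |: T); the sign is real, so conjugation fixes it. *)
Lemma iotaE i u T :
  iota_ i u T = if i \in T then 0 else ext_sign i T * u (i |: T).
Proof.
rewrite ffunE /ext_dot; case: ifPn => iT.
  apply: big1 => S _; rewrite epsE ffunE.
  case: ifP => iS; rewrite ?rmorph0 ?mulr0 //.
  case: eqP => [E|_]; last by rewrite mulr0 rmorph0 mulr0.
  by rewrite -E setD11 in iT.
rewrite (bigD1 (i |: T)) //= big1 ?addr0.
  rewrite epsE setU11 ffunE setU1K // eqxx mulr1 ext_signU1 // ltnn mul1r.
  by rewrite rmorph_sign mulrC.
move=> S ST; rewrite epsE ffunE; case: ifP => iS; rewrite ?rmorph0 ?mulr0 //.
case: eqP => [E|_]; last by rewrite mulr0 rmorph0 mulr0.
by rewrite -E setD1K ?eqxx in ST.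
Qed.

Fact iota_is_linear i : linear (@iota_ R m i).
Proof.
move=> a u v; apply/ffunP => T; rewrite [RHS]ffunE [in RHS]ffunE.
rewrite !iotaE; case: ifP => _; first by rewrite scaler0 addr0.
by rewrite !ffunE /GRing.scale /= mulrDr mulrCA.
Qed.

HB.instance Definition _ i :=
  GRing.isLinear.Build R[i] (ext R m) (ext R m) _ (iota_ i) (iota_is_linear i).

(** The two signs agree, since [i] is not below itself, and so multiply to 1. *)
Lemma eps_iota i u T : eps i (iota_ i u) T = if i \in T then u T else 0.
Proof.
rewrite epsE iotaE setD11; case: ifP => // iT.
by rewrite ext_signD1 // ltnn mul1r mulrA ext_signK mul1r setD1K.
Qed.

Lemma iota_eps i u T : iota_ i (eps i u) T = if i \in T then 0 else u T.
Proof.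
rewrite iotaE epsE setU11; case: ifPn => // iT.
by rewrite ext_signU1 // ltnn mul1r mulrA ext_signK mul1r setU1K.
Qed.

(** Of two distinct indices exactly one is below the other: the source of the minus sign in each
    anticommutation relation below. *)
Lemma sign_ltC i j : i != j ->
  (-1) ^+ (i < j)%N = - (-1) ^+ (j < i)%N :> R[i].
Proof. by rewrite -val_eqE /=; case: ltngtP => // _ _; rewrite ?opprK. Qed.

Lemma eps_epsC i j u : eps i (eps j u) + eps j (eps i u) = 0.
Proof.
apply/ffunP => T; rewrite ffunE [RHS]ffunE !epsE !in_setD1.
have [->|ij] := eqVneq i j.
  (* For [i = j] each term would need [i] to lie in [T :\ i]. *)
  by rewrite mulr0 if_same addr0.
case: ifPn => iT /=; case: ifPn => jT; rewrite ?mulr0 ?addr0 //=.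
rewrite !ext_signD1 // (sign_ltC ij) setDDl setUC -setDDl.
ring.
Qed.

Lemma iota_iotaC i j u : iota_ i (iota_ j u) + iota_ j (iota_ i u) = 0.
Proof.
apply/ffunP => T; rewrite ffunE [RHS]ffunE !iotaE !in_setU1.
have [->|ij] := eqVneq i j.
  by rewrite mulr0 if_same addr0.
case: ifPn => iT /=; case: ifPn => jT; rewrite ?mulr0 ?addr0 //=.
rewrite !ext_signU1 // (sign_ltC ij) setUCA.
ring.
Qed.

Lemma eps_iotaC i j u : i != j -> eps i (iota_ j u) + iota_ j (eps i u) = 0.
Proof.
move=> ij; apply/ffunP => T; rewrite ffunE [RHS]ffunE !epsE !iotaE !epsE.
rewrite in_setD1 in_setU1 (negPf ij) eq_sym ij /=.
case: ifPn => iT; case: ifPn => jT; rewrite ?mulr0 ?addr0 //=.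
rewrite ext_signD1 // ext_signU1 // (sign_ltC ij).
have -> : (j |: T) :\ i = j |: T :\ i.
  apply/setP => k; rewrite !inE; case: (eqVneq k j) => [->|//].
  by rewrite eq_sym ij.
ring.
Qed.

End ExteriorTheory.

(** * Anticommutators of sums of operators A_i (x) D_i *)

Section SpinorTheory.
Context {R : realType} {m : nat}.

Local Notation ext := (ext R m).
Local Notation zwpoly := {mpoly R[i][m + m]}.

Implicit Types (f : Pm R m) (T : {set 'I_m}) (i j : 'I_m) (q : R[i]).

Lemma pol_opE (D : zwpoly -> zwpoly) f T : pol_op D f T = D (f T).
Proof. exact: ffunE. Qed.

Lemma pol_op_compC (D G : zwpoly -> zwpoly) f :
  (forall p, D (G p) = G (D p)) -> pol_op (D \o G) f = pol_op (G \o D) f.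
Proof. by move=> DG; apply/ffunP => T; rewrite !ffunE /= DG. Qed.

(** Matrix multiplication: [D] passes the scalar entries of [B] by linearity, and linearity of [A]
    recombines the columns. *)
Lemma ext_op_comp (A : {linear ext -> ext}) (B : ext -> ext)
    (D : {linear zwpoly -> zwpoly}) (G : zwpoly -> zwpoly) f :
  ext_op A (pol_op D (ext_op B (pol_op G f)))
  = ext_op (A \o B) (pol_op (D \o G) f).
Proof.
apply/ffunP => T; rewrite !ffunE.
under eq_bigr do rewrite !ffunE linear_sum scaler_sumr.
rewrite exchange_big; apply: eq_bigr => S _ /=.
rewrite [B _ in RHS]ext_decomp linear_sum sum_ffunE scaler_suml !ffunE.
apply: eq_bigr => U _.
by rewrite !linearZ /= !ffunE scalerA /GRing.scale /= mulrC.
Qed.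

Lemma ext_op_diag (A : ext -> ext) (c : {set 'I_m} -> R[i]) f T :
  (forall u, A u T = c T * u T) -> ext_op A f T = c T *: f T.
Proof.
move=> AE; rewrite ffunE (bigD1 T) //= big1 ?addr0.
  by rewrite AE ffunE eqxx mulr1.
by move=> S /negPf ST; rewrite AE ffunE eq_sym ST mulr0 scale0r.
Qed.

(** The four operators of the theorem are convertible to this shape, with [eps] or [iota_] for [A]
    and Jackson derivatives or multiplications for [D]. *)
Definition spin_op (A : 'I_m -> ext -> ext) (D : 'I_m -> zwpoly -> zwpoly) f :
    Pm R m :=
  \sum_i ext_op (A i) (pol_op (D i) f).

Lemma ext_op_sum (A : ext -> ext) (D : {linear zwpoly -> zwpoly})
    (I : Type) (r : seq I) (h : I -> Pm R m) :
  ext_op A (pol_op D (\sum_(k <- r) h k))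
  = \sum_(k <- r) ext_op A (pol_op D (h k)).
Proof.
apply/ffunP => T; rewrite sum_ffunE ffunE.
under eq_bigr do rewrite ffunE sum_ffunE linear_sum scaler_sumr.
rewrite exchange_big; apply: eq_bigr => k _; rewrite ffunE.
by apply: eq_bigr => S _; rewrite ffunE.
Qed.

Lemma ext_op_anti (A B : ext -> ext) f :
  (forall u, A u + B u = 0) -> ext_op A f + ext_op B f = 0.
Proof.
move=> AB; apply/ffunP => T; rewrite !ffunE -big_split big1 //= => S _.
have /ffunP/(_ T) := AB (ext_basis S); rewrite !ffunE => ABT.
by rewrite -scalerDl ABT scale0r.
Qed.

Lemma anticomm_spin (A B : 'I_m -> {linear ext -> ext})
    (D G : 'I_m -> {linear zwpoly -> zwpoly}) f :
  anticomm (spin_op A D) (spin_op B G) f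
  = \sum_i \sum_j (ext_op (A i \o B j) (pol_op (D i \o G j) f)
                   + ext_op (B j \o A i) (pol_op (G j \o D i) f)).
Proof.
under [RHS]eq_bigr do rewrite big_split.
rewrite big_split /= [X in _ + X]exchange_big /anticomm /spin_op /=.
congr (_ + _); apply: eq_bigr => i _; rewrite ext_op_sum.
  by apply: eq_bigr => j _; rewrite ext_op_comp.
by apply: eq_bigr => j _; rewrite ext_op_comp.
Qed.

Lemma spin_term0 (A B : {linear ext -> ext}) (D G : zwpoly -> zwpoly) f :
  (forall u, A (B u) + B (A u) = 0) -> (forall p, D (G p) = G (D p)) ->
  ext_op (A \o B) (pol_op (D \o G) f)
  + ext_op (B \o A) (pol_op (G \o D) f) = 0.
Proof.
by move=> AB DG; rewrite (pol_op_compC f DG); exact: ext_op_anti.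
Qed.

Lemma anticomm_spin_eq0 (A B : 'I_m -> {linear ext -> ext})
    (D G : 'I_m -> {linear zwpoly -> zwpoly}) f :
  (forall i j u, A i (B j u) + B j (A i u) = 0) ->
  (forall i j p, D i (G j p) = G j (D i p)) ->
  anticomm (spin_op A D) (spin_op B G) f = 0.
Proof.
move=> AB DG; rewrite anticomm_spin big1 // => i _; rewrite big1 // => j _.
exact: spin_term0.
Qed.

Lemma anticomm_spin_diag (A B : 'I_m -> {linear ext -> ext})
    (D G : 'I_m -> {linear zwpoly -> zwpoly}) f :
  (forall i j u, i != j -> A i (B j u) + B j (A i u) = 0) ->
  (forall i j p, i != j -> D i (G j p) = G j (D i p)) ->
  anticomm (spin_op A D) (spin_op B G) f
  = \sum_i (ext_op (A i \o B i) (pol_op (D i \o G i) f)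
            + ext_op (B i \o A i) (pol_op (G i \o D i) f)).
Proof.
move=> AB DG; rewrite anticomm_spin; apply: eq_bigr => i _.
rewrite (bigD1 i) //= big1 ?addr0 // => j; rewrite eq_sym => ij.
by apply: spin_term0 => [u|p]; [apply: AB|apply: DG].
Qed.

Lemma spin_sqr0 (A : 'I_m -> {linear ext -> ext})
    (D : 'I_m -> {linear zwpoly -> zwpoly}) f :
  (forall i j u, A i (A j u) + A j (A i u) = 0) ->
  (forall i j p, D i (D j p) = D j (D i p)) ->
  spin_op A D (spin_op A D f) = 0.
Proof.
move=> AA DD; set x := LHS.
(* The anticommutator of the operator with itself is twice its square, and 2 is invertible in
   [R[i]]. *)
have X0 : x + x = 0 := anticomm_spin_eq0 f AA DD.
rewrite -[x]scale1r -(@mulVf R[i] 2) ?pnatr_eq0 //.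
by rewrite -scalerA scaler_nat [x *+ 2]mulr2n X0 scaler0.
Qed.

(** The two compositions are the complementary projections onto the e_T with [i \in T] and those
    with [i \notin T]. *)
Lemma ext_op_number_split i f g :
  ext_op (eps i \o iota_ i) f + ext_op (iota_ i \o eps i) g
  = [ffun T : {set 'I_m} => if i \in T then f T else g T].
Proof.
apply/ffunP => T; rewrite [LHS]ffunE [RHS]ffunE.
rewrite (@ext_op_diag (eps i \o _) (fun T => (i \in T)%:R)) => [|u]; last first.
  by rewrite /= eps_iota; case: ifP => _; rewrite ?mul1r ?mul0r.
rewrite (@ext_op_diag _ (fun T => (i \notin T)%:R)) => [|u]; last first.
  by rewrite /= iota_eps; case: ifP => _; rewrite ?mul1r ?mul0r.
by case: ifP => _; rewrite scale1r scale0r ?add0r ?addr0.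
Qed.

Lemma ext_op_eps_iotaD i f :
  ext_op (eps i \o iota_ i) f + ext_op (iota_ i \o eps i) f = f.
Proof.
by rewrite ext_op_number_split; apply/ffunP => T; rewrite ffunE if_same.
Qed.

Lemma ext_op_numop i f T :
  ext_op (numop i) f T = if i \in T then f T else 0.
Proof.
rewrite (@ext_op_diag _ (fun T => (i \in T)%:R)) => [|u].
  by case: ifP => _; rewrite ?scale1r ?scale0r.
by rewrite /= eps_iota; case: ifP => _; rewrite ?mul1r ?mul0r.
Qed.

Lemma complE (A : ext -> ext) (u : ext) T : compl A u T = u T - A u T.
Proof. by rewrite ffunE [X in _ + X]ffunE. Qed.

Lemma qpowE q (A : ext -> ext) (u : ext) T :
  qpow q A u T = q * A u T + compl A u T.
Proof. by rewrite ffunE [X in X + _]ffunE. Qed.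

Lemma ext_op_compl_numop i f T :
  ext_op (compl (numop i)) f T = if i \in T then 0 else f T.
Proof.
rewrite (@ext_op_diag _ (fun T => (i \notin T)%:R)) => [|u].
  by case: ifP => _; rewrite ?scale1r ?scale0r.
rewrite complE /= eps_iota.
by case: ifP => _; rewrite ?subrr ?subr0 ?mul1r ?mul0r.
Qed.

Lemma ext_op_qpow_numop q i f T :
  ext_op (qpow q (numop i)) f T = if i \in T then q *: f T else f T.
Proof.
rewrite (@ext_op_diag _ (fun T => if i \in T then q else 1)) => [|u].
  by case: ifP => _; rewrite ?scale1r.
rewrite qpowE ?complE /= eps_iota.
by case: ifP => _; rewrite ?subrr ?addr0 ?mulr0 ?add0r ?subr0 ?mul1r.
Qed.

Lemma ext_op_qpow_compl_numop q i f T :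
  ext_op (qpow q (compl (numop i))) f T = if i \in T then f T else q *: f T.
Proof.
rewrite (@ext_op_diag _ (fun T => if i \in T then 1 else q)) => [|u].
  by case: ifP => _; rewrite ?scale1r.
rewrite qpowE ?complE /= eps_iota.
by case: ifP => _; rewrite ?subrr ?mulr0 ?add0r ?subr0 ?subrr ?addr0 ?mul1r.
Qed.

(** * Diagonal terms of the anticommutators that mix [eps] and [iota_] *)

Section Clifford.
Context (D G : 'I_m -> {linear zwpoly -> zwpoly}) (f : Pm R m).

(** As [D i] and [G i] commute too, the diagonal term factors through [eps i \o iota_ i] plus
    [iota_ i \o eps i], which is the identity. *)
Lemma anticomm_eps_iota :
  (forall i j p, D i (G j p) = G j (D i p)) ->
  anticomm (spin_op eps D) (spin_op iota_ G) f
  = \sum_i pol_op (D i \o G i) f.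
Proof.
move=> DG; rewrite (anticomm_spin_diag f eps_iotaC (fun i j p _ => DG i j p)).
apply: eq_bigr => i _; rewrite -(pol_op_compC f (DG i i)).
exact: ext_op_eps_iotaD.
Qed.

Hypothesis DGC : forall i j p, i != j -> D i (G j p) = G j (D i p).

Variable q : R[i].
Hypothesis qDG : forall i p, D i (G i p) = p + q *: G i (D i p).

(** Where [i \in T] the order is [D i \o G i], and [qDG] gives the identity plus q times
    [G i \o D i]; elsewhere [G i \o D i] stands alone. The weights (1, q) and (0, 1) are the
    eigenvalues of N_i and q^(N_i). *)
Lemma anticomm_eps_iota_qcomm :
  anticomm (spin_op eps D) (spin_op iota_ G) f
  = \sum_i (ext_op (numop i) f
            + ext_op (qpow q (numop i)) (pol_op (G i \o D i) f)).
Proof.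
rewrite (anticomm_spin_diag f eps_iotaC DGC); apply: eq_bigr => i _.
rewrite ext_op_number_split; apply/ffunP => T.
rewrite [LHS]ffunE [RHS]ffunE ext_op_numop ext_op_qpow_numop !pol_opE /=.
by case: ifP => _; rewrite ?add0r ?qDG.
Qed.

(** The projections trade places: [D i \o G i] now acts where [i \notin T], so N_i becomes 1 -
    N_i. *)
Lemma anticomm_iota_eps_qcomm :
  anticomm (spin_op iota_ D) (spin_op eps G) f
  = \sum_i (ext_op (compl (numop i)) f
            + ext_op (qpow q (compl (numop i))) (pol_op (G i \o D i) f)).
Proof.
have ie i j (u : ext) : i != j -> iota_ i (eps j u) + eps j (iota_ i u) = 0.
  by move=> ij; rewrite addrC eps_iotaC // eq_sym.
rewrite (anticomm_spin_diag f ie DGC); apply: eq_bigr => i _.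
rewrite addrC ext_op_number_split; apply/ffunP => T.
rewrite [LHS]ffunE [RHS]ffunE ext_op_compl_numop ext_op_qpow_compl_numop.
by rewrite !pol_opE /=; case: ifP => _; rewrite ?add0r ?qDG.
Qed.

End Clifford.

End SpinorTheory.

(** * Specialization to Jackson derivatives and multiplications in z and w *)

Theorem theorem2p3 (R : realType) (m : nat) (q : R)
    (hm : (1 <= m)%N) (hq0 : 0 < q) (hq1 : q < 1) (f : Pm R m) :
  [/\ Dq q%:C (Dq q%:C f) = 0,
      Dq_dag q%:C (Dq_dag q%:C f) = 0,
      Zop (Zop f) = 0
    & Zop_dag (Zop_dag f) = 0]
  /\ anticomm Zop Zop_dag f
     = \sum_(i < m) pol_op (mulX (zvar i) \o mulX (wvar i)) f
  /\ anticomm (Dq q%:C) (Dq_dag q%:C) f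
     = \sum_(i < m) pol_op (jackson q%:C (zvar i) \o jackson q%:C (wvar i)) f
  /\ anticomm (Dq q%:C) Zop_dag f = 0
  /\ anticomm (Dq_dag q%:C) Zop f = 0
  /\ anticomm (Dq q%:C) Zop f
     = \sum_(i < m)
         (ext_op (numop i) f
          + ext_op (qpow q%:C (numop i)) (pol_op (qEuler q%:C (zvar i)) f))
  /\ anticomm (Dq_dag q%:C) Zop_dag f
     = \sum_(i < m)
         (ext_op (compl (numop i)) f
          + ext_op (qpow q%:C (compl (numop i)))
                   (pol_op (qEuler q%:C (wvar i)) f)).
Proof.
have q1 : q%:C != 1.
  by rewrite -(rmorph1 (real_complex R)) (inj_eq (@complexI R)) lt_eqF.
have zw (i j : 'I_m) : zvar i != wvar j by rewrite eq_lrshift.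
have wz (i j : 'I_m) : wvar i != zvar j by rewrite eq_rlshift.
have zz (i j : 'I_m) : i != j -> zvar i != zvar j.
  by rewrite (inj_eq (@lshift_inj _ _)).
have ww (i j : 'I_m) : i != j -> wvar i != wvar j.
  by rewrite (inj_eq (@rshift_inj _ _)).
have JJ (i j : 'I_(m + m)) (p : {mpoly R[i][m + m]}) :
    jackson q%:C i (jackson q%:C j p) = jackson q%:C j (jackson q%:C i p).
  by have [->//|ij] := eqVneq i j; apply: jacksonC.
split; first split.
- by apply: spin_sqr0 => i j; [apply: eps_epsC | apply: JJ].
- by apply: spin_sqr0 => i j; [apply: iota_iotaC | apply: JJ].
- by apply: spin_sqr0 => i j; [apply: iota_iotaC | apply: mulXC].
- by apply: spin_sqr0 => i j; [apply: eps_epsC | apply: mulXC].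
split.
  (* [anticomm_eps_iota] takes the [eps] operator first, so the symmetric anticommutator is flipped,
     and the product of z_i and w_i with it. *)
  rewrite [LHS]addrC -[LHS]/(anticomm Zop_dag Zop f).
  under [RHS]eq_bigr do rewrite (pol_op_compC f (mulXC _ _)).
  exact: (anticomm_eps_iota f (fun i j p => mulXC _ _ p)).
split.
  exact: (anticomm_eps_iota f (fun i j p => JJ _ _ p)).
split.
  (* Derivatives in z and multiplications by w involve disjoint variables, so they commute even for
     [i = j]. *)
  apply: anticomm_spin_eq0 => i j p; first exact: eps_epsC.
  exact: jackson_mulXC.
split.
  apply: anticomm_spin_eq0 => i j p; first exact: iota_iotaC.
  exact: jackson_mulXC.
split.
  have DG (i j : 'I_m) p : i != j -> jackson q%:C (zvar i) (mulX (zvar j) p)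
      = mulX (zvar j) (jackson q%:C (zvar i) p).
    by move=> ij; exact: jackson_mulXC p q1 (zz _ _ ij).
  have qcomm := anticomm_eps_iota_qcomm f DG.
  (* [qEuler] unfolds to [mulX] after [jackson], which matches [G i \o D i]. *)
  exact: qcomm _ (fun i p => jackson_mulX (zvar i) p q1).
have DG (i j : 'I_m) p : i != j -> jackson q%:C (wvar i) (mulX (wvar j) p)
    = mulX (wvar j) (jackson q%:C (wvar i) p).
  by move=> ij; exact: jackson_mulXC p q1 (ww _ _ ij).
have qcomm := anticomm_iota_eps_qcomm f DG.
exact: qcomm _ (fun i p => jackson_mulX (wvar i) p q1).
Qed.
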